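(* Let $E$ be an Archimedean vector lattice with the principal projection property, let $F$ be a Dedekind complete vector lattice, and let $\Phi:\mathfrak{B}(E)\to\mathfrak{B}(F)$ be a Boolean homomorphism. Then the set $\Phi(E,F)$ of all atomic operators from $E$ to $F$ subordinate to $\Phi$ is a band in the vector lattice $\mathcal{OA}_{r}(E,F)$ of all regular orthogonally additive operators from $E$ to $F$, and for all $T,S\in\Phi(E,F)$ and all $x\in E$ the following relations hold, where the lattice operations on operators are those of $\mathcal{OA}_r(E,F)$: (1) $(T\vee S)x=Tx\vee Sx$; (2) $(T\wedge S)x=Tx\wedge Sx$; (3) $T^{+}x=(Tx)^{+}$; (4) $T^{-}x=(Tx)^{-}$; (5) $|T|x=|Tx|$.
   Context: All vector lattices are real and Archimedean. Two elements $x,y$ of a vector lattice are disjoint ($x\perp y$) if $|x|\wedge|y|=0$. An order projection on a vector lattice $E$ is a positive linear projection $\pi:E\to E$ with $0\le\pi\le Id$. The set $\mathfrak{B}(E)$ of all order projections on $E$ is a Boolean algebra with the operations $\pi\wedge\rho=\pi\circ\rho$, $\pi\vee\rho=\pi+\rho-\pi\circ\rho$, $\overline{\pi}=Id-\pi$. $E$ has the principal projection property if for every $x\in E$ the band generated by $x$ is a projection band. A Boolean homomorphism is a map between Boolean algebras preserving $\vee$, $\wedge$ and complements. Operators here are possibly nonlinear maps. Given a Boolean homomorphism $\Phi:\mathfrak{B}(E)\to\mathfrak{B}(F)$, a map $T:E\to F$ is an atomic operator subordinate to $\Phi$ if $T\circ\pi=\Phi(\pi)\circ T$ for every $\pi\in\mathfrak{B}(E)$;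 the set of all such maps is denoted $\Phi(E,F)$. A map $T:E\to F$ is orthogonally additive if $T(x+y)=Tx+Ty$ whenever $x\perp y$. It is positive if $Tx\ge 0$ for all $x\in E$. An orthogonally additive map is regular if it is the difference of two positive orthogonally additive maps from $E$ to $F$. $\mathcal{OA}_r(E,F)$ is the vector space of all regular orthogonally additive operators from $E$ to $F$, ordered by $S\le T$ iff $T-S$ is positive. It is known that when $F$ is Dedekind complete, $\mathcal{OA}_r(E,F)$ is a Dedekind complete vector lattice. *)

(* Defs.v *)
From HB Require Import structures.
From mathcomp Require Import all_boot all_order all_algebra.
From mathcomp Require Import boolp classical_sets functions reals.

Set Implicit Arguments.
Unset Strict Implicit.
Unset Printing Implicit Defensive.

Import Order.Theory GRing.Theory Num.Theory.
Local Open Scope ring_scope.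

(* The library's latticeType cannot be joined with lmodType after the numeric
   hierarchy has been declared, so the order is the one of porderZmodType and
   the binary suprema and infima are part of the mixin below. *)
HB.mixin Record POrderedLmodule_isVectorLattice (R : realType) E
    & Num.POrderedZmodule E & GRing.Lmodule R E := {
  vjoin : E -> E -> E;
  vmeet : E -> E -> E;
  vleUx : forall x y z : E, (vjoin x y <= z) = (x <= z) && (y <= z);
  vlexI : forall x y z : E, (z <= vmeet x y) = (z <= x) && (z <= y);
  vler_wD2r : forall x y z : E, x <= y -> x + z <= y + z;
  vscaler_ge0 : forall (a : R) (x : E), 0 <= a -> 0 <= x -> 0 <= a *: x
}.

#[short(type="vlatticeType")]
HB.structure Definition VectorLattice (R : realType) :=
  { E of Num.POrderedZmodule E & GRing.Lmodule R E
       & POrderedLmodule_isVectorLattice R E }.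

Notation "x \vee y" := (vjoin x y) (at level 52, left associativity) : ring_scope.
Notation "x \wedge y" := (vmeet x y) (at level 48, left associativity) : ring_scope.

HB.mixin Record VectorLattice_isDedekindComplete (R : realType) E
    & VectorLattice R E := {
  dedekind_complete : forall D : set E,
    D !=set0%classic -> has_ubound D -> supremums D !=set0%classic
}.

#[short(type="dcVlatticeType")]
HB.structure Definition DedekindVectorLattice (R : realType) :=
  { E of VectorLattice R E & VectorLattice_isDedekindComplete R E }.

Section VectorLatticeDefs.
Context {R : realType} {E : vlatticeType R}.
Implicit Types (x y z : E) (B : set E).

Definition vpos x : E := x \vee 0.
Definition vneg x : E := (- x) \vee 0.
Definition vabs x : E := x \vee (- x).

Definition disjoint_elt x y : Prop := vabs x \wedge vabs y = 0.

Definition is_ideal B : Prop :=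
  [/\ B 0,
      forall (a : R) x y, B x -> B y -> B (a *: x + y)
    & forall x y, B y -> vabs x <= vabs y -> B x].

Definition is_band B : Prop :=
  is_ideal B /\
  forall (D : set E) s, (D `<=` B)%classic -> supremums D s -> B s.

Definition band_generated x : set E :=
  [set z | forall B, is_band B -> B x -> B z]%classic.

Definition disjoint_complement B : set E :=
  [set z | forall y, B y -> disjoint_elt z y]%classic.

Definition is_projection_band B : Prop :=
  is_band B /\
  forall z, exists u v, [/\ B u, disjoint_complement B v & z = u + v].

End VectorLatticeDefs.

Definition archimedean {R : realType} (E : vlatticeType R) : Prop :=
  forall x y : E, 0 <= x -> (forall n : nat, x *+ n <= y) -> x = 0.

Definition principal_projection_property {R : realType} (E : vlatticeType R) :=
  forall x : E, is_projection_band (band_generated x).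

Section VectorLatticeTheory.
Context {R : realType} {E : vlatticeType R}.
Implicit Types (x y z a b c u v : E).

Lemma vleUl x y : x <= x \vee y.
Proof. by have := vleUx x y (x \vee y); rewrite lexx => /esym/andP[]. Qed.

Lemma vleUr x y : y <= x \vee y.
Proof. by have := vleUx x y (x \vee y); rewrite lexx => /esym/andP[]. Qed.

Lemma vleIl x y : x \wedge y <= x.
Proof. by have := vlexI x y (x \wedge y); rewrite lexx => /esym/andP[]. Qed.

Lemma vleIr x y : x \wedge y <= y.
Proof. by have := vlexI x y (x \wedge y); rewrite lexx => /esym/andP[]. Qed.

Lemma vjoinC x y : x \vee y = y \vee x.
Proof. by apply/le_anti; rewrite !vleUx !vleUl !vleUr. Qed.

Lemma vmeetC x y : x \wedge y = y \wedge x.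
Proof. by apply/le_anti; rewrite !vlexI !vleIl !vleIr. Qed.

Lemma vjoin_r x y : x <= y -> x \vee y = y.
Proof. by move=> xy; apply/le_anti; rewrite vleUx xy lexx vleUr. Qed.

Lemma vmeet_l x y : x <= y -> x \wedge y = x.
Proof. by move=> xy; apply/le_anti; rewrite vlexI xy lexx vleIl. Qed.

Lemma vmeet_r x y : y <= x -> x \wedge y = y.
Proof. by move=> xy; rewrite vmeetC vmeet_l. Qed.

Lemma vjoinxx x : x \vee x = x. Proof. exact: vjoin_r. Qed.

Lemma vmeetxx x : x \wedge x = x. Proof. exact: vmeet_l. Qed.

Lemma vmeetACA x y z t :
  (x \wedge y) \wedge (z \wedge t) = (x \wedge z) \wedge (y \wedge t).
Proof.
by apply/eqP; rewrite eq_le; apply/andP; split; rewrite !vlexI;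
  rewrite ?(le_trans (vleIl _ _) (vleIl _ _))
          ?(le_trans (vleIl _ _) (vleIr _ _))
          ?(le_trans (vleIr _ _) (vleIl _ _))
          ?(le_trans (vleIr _ _) (vleIr _ _)).
Qed.

Lemma vjoinACA x y z t :
  (x \vee y) \vee (z \vee t) = (x \vee z) \vee (y \vee t).
Proof.
by apply/eqP; rewrite eq_le; apply/andP; split; rewrite !vleUx;
  rewrite ?(le_trans (vleUl _ _) (vleUl _ _))
          ?(le_trans (vleUr _ _) (vleUl _ _))
          ?(le_trans (vleUl _ _) (vleUr _ _))
          ?(le_trans (vleUr _ _) (vleUr _ _)).
Qed.

Lemma vlerD2r z x y : (x + z <= y + z) = (x <= y).
Proof.
apply/idP/idP => [/(vler_wD2r _ _ (- z))|]; last exact: vler_wD2r.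
by rewrite !addrK.
Qed.

Lemma vlerD2l z x y : (z + x <= z + y) = (x <= y).
Proof. by rewrite ![z + _]addrC vlerD2r. Qed.

Lemma vlerBlD x y z : (x - y <= z) = (x <= z + y).
Proof. by rewrite -(vlerD2r y (x - y)) subrK. Qed.

Lemma vlerBrD x y z : (x <= y - z) = (x + z <= y).
Proof. by rewrite -(vlerD2r z x (y - z)) subrK. Qed.

Lemma vsubr_ge0 x y : (0 <= y - x) = (x <= y).
Proof. by rewrite vlerBrD add0r. Qed.

Lemma vlerN2 x y : (- x <= - y) = (y <= x).
Proof. by rewrite -(vlerD2r (x + y) (- x)) addKr [x + y]addrC addKr. Qed.

Lemma vlerD x y u v : x <= y -> u <= v -> x + u <= y + v.
Proof. by move=> xy uv; apply: (@le_trans _ _ (y + u)); rewrite ?vlerD2r ?vlerD2l. Qed.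

Lemma vaddr_ge0 x y : 0 <= x -> 0 <= y -> 0 <= x + y.
Proof. by move=> x0 y0; rewrite -[leLHS]addr0 vlerD. Qed.

Lemma vlerDl x y : 0 <= y -> x <= x + y.
Proof. by move=> y0; rewrite -[leLHS]addr0 vlerD2l. Qed.

Lemma vjoinDr x y z : (x \vee y) + z = (x + z) \vee (y + z).
Proof.
apply/le_anti/andP; split; last by rewrite vleUx !vlerD2r vleUl vleUr.
by rewrite -vlerBrD vleUx !vlerBrD vleUl vleUr.
Qed.

Lemma voppI x y : - (x \wedge y) = (- x) \vee (- y).
Proof.
apply/le_anti/andP; split; last by rewrite vleUx !vlerN2 vleIl vleIr.
by rewrite -vlerN2 opprK vlexI -(vlerN2 x) -(vlerN2 y) !opprK vleUl vleUr.
Qed.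

Lemma vaddUI x y : x + y = (x \vee y) + (x \wedge y).
Proof.
apply/eqP; rewrite -subr_eq voppI addrC vjoinDr; apply/eqP.
by rewrite addKr [x + y]addrC addKr vjoinC.
Qed.

Lemma vhalf_ge0 x : 0 <= x + x -> 0 <= x.
Proof.
move=> /(vscaler_ge0 (2^-1 : R)); rewrite invr_ge0 => /(_ (ler0n _ _)).
by rewrite -mulr2n -scaler_nat scalerA mulVf ?pnatr_eq0// scale1r.
Qed.

Lemma vabs_ge0 x : 0 <= vabs x.
Proof. by apply: vhalf_ge0; rewrite -(subrr x) vlerD ?vleUl ?vleUr. Qed.

Lemma vpos_ge0 x : 0 <= vpos x. Proof. exact: vleUr. Qed.

Lemma vnegE x : vneg x = vpos (- x). Proof. by []. Qed.

Lemma vneg_ge0 x : 0 <= vneg x. Proof. exact: vleUr. Qed.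

Lemma vposBneg x : vpos x - vneg x = x.
Proof.
apply/eqP; rewrite subr_eq; apply/eqP.
by rewrite addrC vjoinDr addNr add0r vjoinC.
Qed.

Lemma vpos_le_abs x : vpos x <= vabs x.
Proof. by rewrite vleUx vleUl vabs_ge0. Qed.

Lemma vabsN x : vabs (- x) = vabs x.
Proof. by rewrite /vabs opprK vjoinC. Qed.

Lemma vneg_le_abs x : vneg x <= vabs x.
Proof. by rewrite vnegE -vabsN vpos_le_abs. Qed.

Lemma vpos_neg_disj x : vpos x \wedge vneg x = 0.
Proof.
have h : vpos x + vneg x = vpos x \vee vneg x.
  apply/le_anti/andP; split; last first.
    by rewrite vleUx vlerDl ?vneg_ge0// addrC vlerDl ?vpos_ge0.
  rewrite addrC {1}/vneg vjoinDr vleUx add0r vleUl andbT.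
  by rewrite addrC -{2}[x]vposBneg opprB addrC subrK vleUr.
by apply: (addrI (vpos x \vee vneg x)); rewrite -vaddUI addr0.
Qed.

Lemma vabsE x : vabs x = vpos x + vneg x.
Proof.
rewrite vaddUI vpos_neg_disj addr0 /vpos /vneg.
by rewrite vjoinACA vjoinxx vjoinC; apply/esym/vjoin_r; exact: vabs_ge0.
Qed.

Lemma vmeet_mono a b c d : 0 <= a -> 0 <= c -> a <= b -> c <= d ->
  b \wedge d = 0 -> a \wedge c = 0.
Proof.
move=> a0 c0 ab cd bd; apply/le_anti; rewrite vlexI a0 c0 andbT -bd vlexI.
by rewrite (le_trans (vleIl _ _) ab) (le_trans (vleIr _ _) cd).
Qed.

Lemma vdisjDl a b c : 0 <= a -> 0 <= b -> 0 <= c ->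
  a \wedge c = 0 -> b \wedge c = 0 -> (a + b) \wedge c = 0.
Proof.
move=> a0 b0 c0 ac bc; apply/le_anti/andP; split; last first.
  by rewrite vlexI vaddr_ge0.
set z := _ \wedge _; have zc : z <= c by exact: vleIr.
rewrite -ac vlexI zc andbT -[a]add0r -vlerBlD -bc vlexI; apply/andP; split.
  by rewrite vlerBlD [b + a]addrC vleIl.
by rewrite vlerBlD (le_trans zc)// vlerDl.
Qed.

Lemma vmeetDr a b c : 0 <= a -> 0 <= b -> 0 <= c -> a \wedge b = 0 ->
  c \wedge (a + b) = (c \wedge a) + (c \wedge b).
Proof.
move=> a0 b0 c0 ab; apply/le_anti/andP; split.
  rewrite [leRHS]addrC -vlerBlD voppI [leLHS]addrC vjoinDr vleUx.
  apply/andP; split.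
    apply: (@le_trans _ _ 0); last by rewrite vlexI c0.
    by rewrite [leLHS]addrC vlerBlD add0r vleIl.
  rewrite [leLHS]addrC; set z := _ \wedge (a + b).
  have zc : z <= c by exact: vleIl.
  rewrite vlexI !vlerBlD [b + a]addrC vleIr andbT.
  by rewrite (le_trans zc)// vlerDl.
rewrite vlexI; apply/andP; split; last by rewrite vlerD ?vleIr.
rewrite vaddUI vmeetACA vmeetxx ab; have -> : c \wedge 0 = 0 by exact/vmeet_r.
by rewrite addr0 vleUx !vleIl.
Qed.

Lemma vposB a b : a \wedge b = 0 -> vpos (a - b) = a.
Proof.
move=> ab; rewrite /vpos -[X in _ \vee X](subrr b) -vjoinDr.
by apply/eqP; rewrite subr_eq vaddUI ab addr0.
Qed.

Lemma disjoint_eltC x y : disjoint_elt x y -> disjoint_elt y x.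
Proof. by rewrite /disjoint_elt vmeetC. Qed.

Lemma disjoint_le x y u v : vabs u <= vabs x -> vabs v <= vabs y ->
  disjoint_elt x y -> disjoint_elt u v.
Proof. by apply: vmeet_mono; exact: vabs_ge0. Qed.

Lemma disjoint_opp x y : disjoint_elt x y -> disjoint_elt (- x) (- y).
Proof. by rewrite /disjoint_elt !vabsN. Qed.

Lemma vabs0 : vabs (0 : E) = 0.
Proof. by rewrite /vabs oppr0 vjoinxx. Qed.

Lemma disjoint0 x : disjoint_elt 0 x.
Proof. by rewrite /disjoint_elt vabs0; apply/vmeet_l/vabs_ge0. Qed.

Lemma disj_posneg x y : disjoint_elt x y -> vpos x \wedge vneg y = 0.
Proof.
by apply: vmeet_mono; rewrite ?vpos_ge0 ?vneg_ge0 ?vpos_le_abs ?vneg_le_abs.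
Qed.

Lemma disj_pos x y : disjoint_elt x y -> vpos x \wedge vpos y = 0.
Proof.
by apply: vmeet_mono; rewrite ?vpos_ge0 ?vneg_ge0 ?vpos_le_abs ?vneg_le_abs.
Qed.

Lemma vposD x y : disjoint_elt x y -> vpos (x + y) = vpos x + vpos y.
Proof.
move=> xy; rewrite -{1}[x]vposBneg -{1}[y]vposBneg addrACA -opprD.
apply: vposB; have p0 := vpos_ge0; have n0 := vneg_ge0.
apply: vdisjDl; rewrite ?vaddr_ge0//; rewrite vmeetC; apply: vdisjDl => //;
  rewrite vmeetC ?vpos_neg_disj ?disj_posneg//; exact: disjoint_eltC.
Qed.

Lemma vnegD x y : disjoint_elt x y -> vneg (x + y) = vneg x + vneg y.
Proof. by move=> xy; rewrite !vnegE opprD vposD//; exact: disjoint_opp. Qed.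

Lemma vabsB_le a b : 0 <= a -> 0 <= b -> vabs (a - b) <= a + b.
Proof.
move=> a0 b0; rewrite vleUx opprB ![_ + b]addrC ![_ + a]addrC.
rewrite !vlerBlD -!addrA; apply/andP; split.
  by apply: vlerDl; rewrite vaddr_ge0.
by rewrite addrCA; apply: vlerDl; rewrite vaddr_ge0.
Qed.

Definition frag y x : Prop := disjoint_elt y (x - y).

Lemma vabsD x y : disjoint_elt x y -> vabs (x + y) = vabs x + vabs y.
Proof. by move=> xy; rewrite !vabsE vposD// vnegD// addrACA. Qed.

Lemma frag_abs y x : frag y x -> vabs y <= vabs x.
Proof. by move=> /vabsD; rewrite addrC subrK => ->; apply/vlerDl/vabs_ge0. Qed.

Lemma frag_absB y x : frag y x -> vabs (x - y) <= vabs x.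
Proof.
move=> /vabsD; rewrite [y + _]addrC subrK => ->.
by rewrite [leRHS]addrC; apply/vlerDl/vabs_ge0.
Qed.

Lemma frag0 x : frag 0 x. Proof. exact: disjoint0. Qed.

Lemma fragxx x : frag x x.
Proof. by rewrite /frag subrr; apply/disjoint_eltC/disjoint0. Qed.

Lemma disjointD x y z : disjoint_elt x z -> disjoint_elt y z ->
  disjoint_elt (x + y) z.
Proof.
move=> xz yz; have a0 := vabs_ge0.
apply: (@vmeet_mono _ (vabs x + vabs y) _ (vabs z)) => //; last first.
  exact: vdisjDl.
rewrite vleUx opprD !vlerD ?vleUl ?vleUr//.
Qed.

Lemma fragD x1 x2 y1 y2 : disjoint_elt x1 x2 -> frag y1 x1 -> frag y2 x2 ->
  frag (y1 + y2) (x1 + x2).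
Proof.
move=> x12 f1 f2; rewrite /frag opprD addrACA.
have [a1 b1] := (frag_abs f1, frag_absB f1).
have [a2 b2] := (frag_abs f2, frag_absB f2).
apply: disjointD; apply/disjoint_eltC/disjointD; apply/disjoint_eltC => //.
  exact: disjoint_le x12.
apply: disjoint_le (disjoint_eltC x12) => //.
Qed.

Lemma frag_split_pos a b c d : 0 <= a -> 0 <= b -> 0 <= c -> 0 <= d ->
  c \wedge d = 0 -> a + b = c + d -> a = (a \wedge c) + (a \wedge d).
Proof.
move=> a0 b0 c0 d0 cd abcd; rewrite -vmeetDr// -abcd.
by apply/esym/vmeet_l; exact: vlerDl.
Qed.

Lemma frag_split x1 x2 y : disjoint_elt x1 x2 -> frag y (x1 + x2) ->
  exists y1 y2, [/\ frag y1 x1, frag y2 x2 & y = y1 + y2].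
Proof.
move=> x12; set z := x1 + x2 - y => yz; have yzE : y + z = x1 + x2.
  by rewrite addrC subrK.
have p0 := vpos_ge0; have n0 := vneg_ge0.
pose m a b := (vpos a \wedge vpos b) - (vneg a \wedge vneg b).
have mabs a b : vabs (m a b) <= vabs a.
  apply: (le_trans (vabsB_le _ _)); rewrite ?vlexI ?p0 ?n0//.
  by rewrite vabsE; apply: vlerD; rewrite vleIl.
have mC a b : m a b = m b a by rewrite /m vmeetC [vneg a \wedge _]vmeetC.
have mD a b c d : disjoint_elt a b -> disjoint_elt c d -> a + b = c + d ->
    a = m a c + m a d.
  move=> ab cd e; rewrite -{1}[a]vposBneg addrACA -opprD; congr (_ - _).
    apply: (@frag_split_pos _ (vpos b)) => //; first exact: disj_pos.
    by rewrite -!vposD// e.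
  apply: (@frag_split_pos _ (vneg b)) => //.
    by rewrite !vnegE; apply/disj_pos/disjoint_opp.
  by rewrite -!vnegD// e.
have e1 := mD _ _ _ _ x12 yz (esym yzE).
have e2 : x2 = m x2 y + m x2 z.
  apply: (mD _ x1) => //; first exact: disjoint_eltC.
  by rewrite addrC yzE.
exists (m y x1), (m y x2); split; last exact: (mD _ z).
- rewrite /frag {2}e1 [m x1 y]mC addrAC subrr add0r [m x1 z]mC.
  exact: disjoint_le yz.
- rewrite /frag {2}e2 [m x2 y]mC addrAC subrr add0r [m x2 z]mC.
  exact: disjoint_le yz.
Qed.

End VectorLatticeTheory.

Lemma dedekind_archimedean (R : realType) (F : dcVlatticeType R) :
  archimedean F.
Proof.
move=> x y x0 nxy.
have [||s [us ls]] := @dedekind_complete _ F [set x *+ n | n in setT]%classic _ _.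
- by exists 0; exists 0%N.
- by exists y => _ [n _ <-].
apply/le_anti; rewrite x0 andbT -(vlerD2l (s - x)) addr0 subrK.
by apply: ls => _ [n _ <-]; rewrite vlerBrD -mulrSr; apply: us; exists n.+1.
Qed.

Record order_proj {R : realType} (E : vlatticeType R) := OrderProj {
  order_proj_fun :> E -> E;
  order_proj_linear : linear order_proj_fun;
  order_proj_idem : forall x, order_proj_fun (order_proj_fun x) = order_proj_fun x;
  order_proj_ge0 : forall x, 0 <= x -> 0 <= order_proj_fun x;
  order_proj_le_id : forall x, 0 <= x -> order_proj_fun x <= x
}.

Section OrderProjections.
Context {R : realType} {E : vlatticeType R}.
Implicit Types (p q : order_proj E).

HB.instance Definition _ p :=
  GRing.isLinear.Build R E E *:%R (order_proj_fun p) (order_proj_linear p).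

Lemma order_proj_ext p q : p =1 q -> p = q.
Proof.
case: p q => [f l1 i1 g1 h1] [g l2 i2 g2 h2] /= /funext fg.
by case: _ / fg l2 i2 g2 h2 => l2 i2 g2 h2; congr OrderProj; exact: Prop_irrelevance.
Qed.

Lemma order_proj_mono p x y : x <= y -> p x <= p y.
Proof. by rewrite -vsubr_ge0 => /(order_proj_ge0 p); rewrite linearB vsubr_ge0. Qed.

Lemma order_projC p q x : p (q x) = q (p x).
Proof.
suff H p' q' y : 0 <= y -> p' (q' y) = p' (q' (p' y)) /\ q' (p' y) = p' (q' (p' y)).
  have H' y : 0 <= y -> p (q y) = q (p y).
    by move=> y0; have [-> <-] := H p q y y0.
  by rewrite -[x]vposBneg !linearB /= !H' ?vpos_ge0 ?vneg_ge0.
move=> y0; split; apply/eqP; rewrite -subr_eq0; apply/eqP/le_anti/andP; split.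
- rewrite -!linearB.
  have h : 0 <= y - p' y by rewrite vsubr_ge0 order_proj_le_id.
  apply: le_trans (order_proj_mono p' (order_proj_le_id q' h)) _.
  by rewrite linearB /= order_proj_idem subrr.
- rewrite -!linearB; apply/order_proj_ge0/order_proj_ge0.
  by rewrite vsubr_ge0 order_proj_le_id.
- set w := q' (p' y); have w0 : 0 <= p' y - w.
    by rewrite vsubr_ge0; apply/order_proj_le_id/order_proj_ge0.
  have := order_proj_le_id p' w0; rewrite linearB /= order_proj_idem.
  by rewrite vlerD2l vlerN2 -(vlerD2r (- p' w)) subrr.
- by rewrite vsubr_ge0; apply/order_proj_le_id/order_proj_ge0/order_proj_ge0.
Qed.

#[local] Obligation Tactic := idtac.

Program Definition op_meet p q : order_proj E :=
  @OrderProj R E (fun x => p (q x)) _ _ _ _.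
Next Obligation. by move=> p q a x y; rewrite !linearP. Qed.
Next Obligation.
by move=> p q x /=; rewrite (order_projC q p) !order_proj_idem.
Qed.
Next Obligation. by move=> p q x x0; do 2!apply: order_proj_ge0. Qed.
Next Obligation.
by move=> p q x x0; apply: le_trans (order_proj_le_id q x0);
  apply/order_proj_le_id/order_proj_ge0.
Qed.

Program Definition op_compl p : order_proj E :=
  @OrderProj R E (fun x => x - p x) _ _ _ _.
Next Obligation.
by move=> p a x y; rewrite linearP opprD addrACA scalerBr.
Qed.
Next Obligation.
by move=> p x /=; rewrite linearB /= order_proj_idem subrr subr0.
Qed.
Next Obligation. by move=> p x x0; rewrite vsubr_ge0 order_proj_le_id. Qed.
Next Obligation.
by move=> p x x0; rewrite vlerBlD; apply/vlerDl/order_proj_ge0.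
Qed.

Lemma op_join_subproof p q x :
  p x + q x - p (q x) = op_compl (op_meet (op_compl p) (op_compl q)) x.
Proof.
rewrite /= (linearB p) /= [- (_ - _ - _)]opprB opprB [RHS]addrC -[RHS]addrA subrK.
by rewrite addrAC.
Qed.

Program Definition op_join p q : order_proj E :=
  @OrderProj R E (fun x => p x + q x - p (q x)) _ _ _ _.
Next Obligation. by move=> p q a x y; rewrite /= !op_join_subproof linearP. Qed.
Next Obligation. by move=> p q x; rewrite /= !op_join_subproof order_proj_idem. Qed.
Next Obligation.
by move=> p q x x0; rewrite /= op_join_subproof; exact: order_proj_ge0.
Qed.
Next Obligation.
by move=> p q x x0; rewrite /= op_join_subproof; exact: order_proj_le_id.
Qed.

End OrderProjections.

Definition boolean_hom {R : realType} {E F : vlatticeType R}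
    (Phi : order_proj E -> order_proj F) : Prop :=
  [/\ forall p q, Phi (op_join p q) = op_join (Phi p) (Phi q),
      forall p q, Phi (op_meet p q) = op_meet (Phi p) (Phi q)
    & forall p, Phi (op_compl p) = op_compl (Phi p)].

Definition atomic_ops {R : realType} {E F : vlatticeType R}
    (Phi : order_proj E -> order_proj F) : set (E -> F) :=
  [set T : E -> F | forall p : order_proj E, T \o p = Phi p \o T]%classic.

Section OrthogonallyAdditive.
Context {R : realType} {E F : vlatticeType R}.
Implicit Types T : E -> F.

Definition orth_additive T : Prop :=
  forall x y, disjoint_elt x y -> T (x + y) = T x + T y.

Definition positive_op T : Prop := forall x, 0 <= T x.

Definition regular_oa T : Prop :=
  orth_additive T /\
  exists A B : E -> F,
    [/\ orth_additive A /\ positive_op A, orth_additive B /\ positive_op B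
      & T = A - B].

Lemma orth_additive0 T : orth_additive T -> T 0 = 0.
Proof.
move=> oT; have /oT := @disjoint0 R E 0; rewrite addr0.
by move=> /eqP; rewrite addrC -subr_eq subrr eq_sym => /eqP.
Qed.

Lemma regular_oaP T A B : orth_additive A -> positive_op A ->
  orth_additive B -> positive_op B -> T = A - B -> regular_oa T.
Proof.
move=> oA pA oB pB ->; split; last by exists A, B.
move=> x y xy; have -> z : (A - B) z = A z - B z by [].
by rewrite oA// oB// opprD addrACA.
Qed.

Definition regular_oa_pred : {pred E -> F} := fun T => `[< regular_oa T >].

Lemma regular_oa_closed : submod_closed regular_oa_pred.
Proof.
have oaD T S : orth_additive T -> orth_additive S -> orth_additive (T + S).
  by move=> oT oS x y xy; rewrite !addrfctE oT// oS// addrACA.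
have oaZ (a : R) T : orth_additive T -> orth_additive (a *: T).
  by move=> oT x y xy; rewrite !scalrfctE oT// scalerDr.
have pD T S : positive_op T -> positive_op S -> positive_op (T + S).
  by move=> pT pS x; exact: vaddr_ge0.
have pZ (a : R) T : 0 <= a -> positive_op T -> positive_op (a *: T).
  by move=> a0 pT x; exact: vscaler_ge0.
split.
  apply/asboolP; apply: (@regular_oaP _ 0 0); rewrite ?subrr//.
  - by move=> x y _; rewrite addr0.
  - by move=> x y _; rewrite addr0.
move=> a T S /asboolP[_ [A [B [[oA pA] [oB pB] ->]]]].
move=> /asboolP[_ [C [D [[oC pC] [oD pD' ->]]]]]; apply/asboolP.
have [a0|/ltW a0] := leP 0 a.
  apply: (@regular_oaP _ (a *: A + C) (a *: B + D)); auto.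
  by rewrite scalerBr opprD addrACA.
apply: (@regular_oaP _ ((- a) *: B + C) ((- a) *: A + D)).
- by auto.
- by apply: pD => //; apply: pZ; rewrite ?oppr_ge0.
- by auto.
- by apply: pD => //; apply: pZ; rewrite ?oppr_ge0.
- by rewrite scalerBr !scaleNr [- (_ + D)]opprD opprK [RHS]addrACA [- _ + a *: A]addrC.
Qed.

End OrthogonallyAdditive.

HB.instance Definition _ (R : realType) (E F : vlatticeType R) :=
  GRing.isSubmodClosed.Build R (E -> F) (@regular_oa_pred R E F)
    regular_oa_closed.

Record OAr {R : realType} (E F : vlatticeType R) := MkOAr {
  OAr_fun :> E -> F;
  OAr_regular : regular_oa_pred OAr_fun
}.

Section OArStructure.
Context {R : realType} {E F : vlatticeType R}.

HB.instance Definition _ := [isSub for @OAr_fun R E F].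
HB.instance Definition _ := [Choice of OAr E F by <:].
HB.instance Definition _ := [SubChoice_isSubLmodule of OAr E F by <:].

Implicit Types T S : OAr E F.

Definition OAr_le T S : bool := `[< positive_op ((S : E -> F) - T) >].

Lemma OAr_leP T S : reflect (forall x, T x <= S x) (OAr_le T S).
Proof.
by apply: (iffP (asboolP _)) => h x; have := h x; rewrite vsubr_ge0.
Qed.

Lemma OAr_ext T S : T =1 S -> T = S.
Proof. by move=> /funext TS; apply: val_inj. Qed.

Lemma OAr_le_refl : reflexive OAr_le.
Proof. by move=> T; apply/OAr_leP. Qed.

Lemma OAr_le_anti : antisymmetric OAr_le.
Proof.
move=> T S /andP[/OAr_leP TS /OAr_leP ST]; apply: OAr_ext => x.
by apply/le_anti; rewrite TS ST.
Qed.

Lemma OAr_le_trans : transitive OAr_le.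
Proof.
move=> T S U /OAr_leP h1 /OAr_leP h2; apply/OAr_leP => x.
exact: le_trans (h1 x) (h2 x).
Qed.

HB.instance Definition _ := Order.Le_isPOrder.Build ring_display (OAr E F)
  OAr_le_refl OAr_le_anti OAr_le_trans.

Lemma OAr_lerP T S : reflect (forall x, T x <= S x) (T <= S).
Proof. exact: OAr_leP. Qed.

Lemma OAr_orth_additive T : orth_additive T.
Proof. by have /asboolP[] := OAr_regular T. Qed.

Lemma OAr_addE T S x : (T + S) x = T x + S x. Proof. by []. Qed.
Lemma OAr_oppE T x : (- T) x = - T x. Proof. by []. Qed.
Lemma OAr_scaleE (a : R) T x : (a *: T) x = a *: T x. Proof. by []. Qed.
Lemma OAr_zeroE x : (0 : OAr E F) x = 0. Proof. by []. Qed.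

End OArStructure.

Section OArLattice.
Context {R : realType} {E : vlatticeType R} {F : dcVlatticeType R}.
Implicit Types T S U : OAr E F.

(* The positive part of T is x |-> sup {T y | y is a fragment of x}. *)
Lemma OAr_pos_exists T : exists U,
  [/\ T <= U, 0 <= U & forall V : OAr E F, T <= V -> 0 <= V -> U <= V].
Proof.
have oT := OAr_orth_additive T.
have /asboolP[_ [A [B [[oA pA] [_ pB] TE]]]] := OAr_regular T.
have TA y : T y <= A y.
  by rewrite TE -vsubr_ge0 addrfctE opprfctE opprB [A y + _]addrC subrK.
pose D (x : E) : set F := [set T y | y in [set y | frag y x]]%classic.
have ex (x : E) : exists s, supremums (D x) s.
  apply: dedekind_complete; first by exists (T 0), 0 => //; exact: frag0.
  exists (A x) => _ [y yx <-]; apply: (le_trans (TA y)).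
  have -> : A x = A y + A (x - y) by rewrite -oA// [y + _]addrC subrK.
  exact: vlerDl.
pose P x := projT1 (cid (ex x)).
have PU x y : frag y x -> T y <= P x.
  by move=> yx; have [+ _] := projT2 (cid (ex x)); apply; exists y.
have PL x z : (forall y, frag y x -> T y <= z) -> P x <= z.
  move=> h; have [_ +] := projT2 (cid (ex x)); apply => _ [y yx <-].
  exact: h.
have P0 : positive_op P.
  by move=> x; rewrite -(orth_additive0 oT); apply/PU/frag0.
have oP : orth_additive P.
  move=> x1 x2 x12; apply/le_anti/andP; split.
    apply: PL => y /(frag_split x12)[y1 [y2 [f1 f2 ->]]].
    rewrite oT; first by apply: vlerD; exact: PU.
    exact: disjoint_le (frag_abs f1) (frag_abs f2) x12.
  rewrite -vlerBrD; apply: (PL) => y1 f1.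
  rewrite vlerBrD [leLHS]addrC -vlerBrD; apply: PL => y2 f2.
  rewrite vlerBrD [leLHS]addrC -oT; first by apply/PU/fragD.
  exact: disjoint_le (frag_abs f1) (frag_abs f2) x12.
have rP : regular_oa_pred P.
  apply/asboolP; apply: (@regular_oaP _ _ _ P P 0) => //.
  - by move=> x y _; rewrite addr0.
  - by rewrite subr0.
exists (MkOAr rP); split.
- by apply/OAr_lerP => x; apply/PU/fragxx.
- by apply/OAr_lerP => x; exact: P0.
move=> V /OAr_lerP TV /OAr_lerP V0; apply/OAr_lerP => x; apply: PL => y yx.
apply: (le_trans (TV y)).
have -> : V x = V y + V (x - y).
  by rewrite -(OAr_orth_additive V)// [y + _]addrC subrK.
by apply: vlerDl; exact: V0.
Qed.

Lemma OAr_wD2r T S U : T <= S -> T + U <= S + U.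
Proof.
by move=> /OAr_lerP h; apply/OAr_lerP => x; rewrite !OAr_addE vlerD2r.
Qed.

Lemma OAr_D2r U T S : (T + U <= S + U) = (T <= S).
Proof.
by apply/idP/idP => [/(OAr_wD2r (- U))|]; [rewrite !addrK|exact: OAr_wD2r].
Qed.

Lemma OAr_join_exists T S : exists J : OAr E F, forall V : OAr E F,
  (J <= V) = (T <= V) && (S <= V).
Proof.
have [U [TSU U0 Umin]] := OAr_pos_exists (T - S).
have SE V : (S <= V) = (0 <= V - S) by rewrite -(OAr_D2r S 0) add0r subrK.
have TE V : (T <= V) = (T - S <= V - S) by rewrite OAr_D2r.
exists (U + S) => V; rewrite -(OAr_D2r (- S) (U + S)) addrK TE SE.
apply/idP/andP => [UV|[]]; last exact: Umin.
by split; [exact: le_trans UV|exact: le_trans UV].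
Qed.

Definition OAr_join T S : OAr E F := projT1 (cid (OAr_join_exists T S)).

Definition OAr_meet T S : OAr E F := - OAr_join (- T) (- S).

Lemma OAr_leUx T S U : (OAr_join T S <= U) = (T <= U) && (S <= U).
Proof. exact: projT2 (cid (OAr_join_exists T S)) U. Qed.

Lemma OAr_lexI T S U : (U <= OAr_meet T S) = (U <= T) && (U <= S).
Proof.
have N2 (V W : OAr E F) : (- V <= - W) = (W <= V).
  by rewrite -(OAr_D2r (V + W) (- V)) addKr [V + W]addrC addKr.
by rewrite -N2 opprK OAr_leUx !N2.
Qed.

Lemma OAr_scale_ge0 (a : R) T : 0 <= a -> 0 <= T -> 0 <= a *: T.
Proof.
move=> a0 /OAr_lerP T0; apply/OAr_lerP => x; rewrite OAr_scaleE.
exact: vscaler_ge0 (T0 x).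
Qed.

HB.instance Definition _ :=
  POrderedLmodule_isVectorLattice.Build R (OAr E F)
    OAr_leUx OAr_lexI OAr_wD2r OAr_scale_ge0.

End OArLattice.

(* Main.v *)
(** Order projections are lattice homomorphisms, so pointwise suprema and
    infima of atomic operators are again atomic.  Under the principal projection
    property, disjoint [x] and [y] are separated by the projection onto the band
    of [x], whence every atomic operator is orthogonally additive, and regular
    because [x |-> (T x)^+] and [x |-> (T x)^-] are atomic.  The lattice
    operations of two atomic operators are therefore the pointwise ones.

    An orthogonally additive [S] is atomic as soon as [Phi (Id - p)] kills
    [S (p x)] for all [p] and [x].  This is inherited by every [S] with
    [|S| <= |T|].  For a supremum [s] of atomic operators, the operator
    [x |-> Phi p (s (p x)) + Phi (Id - p) (s (x - p x))] is another upper bound;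
    comparing it with [s] at [p x] gives [Phi (Id - p) (s (p x)) <= 0]. *)
Require Import Defs.
From mathcomp Require Import all_boot all_order all_algebra.
From mathcomp Require Import boolp classical_sets functions reals.

Set Implicit Arguments.
Unset Strict Implicit.
Unset Printing Implicit Defensive.

Import Order.Theory GRing.Theory Num.Theory.
Local Open Scope ring_scope.

(** * Disjointness, bands, and the separation of disjoint elements *)

Section Disjointness.
Context {R : realType} {E : vlatticeType R}.
Implicit Types (x y z u v : E) (B : set E).

Lemma vjoinE x y : x \vee y = vpos (x - y) + y.
Proof. by rewrite /vpos vjoinDr subrK add0r. Qed.

Lemma vmeetE x y : x \wedge y = - (- x \vee - y).
Proof. by rewrite -voppI opprK. Qed.

Lemma vabs_ge x : x <= vabs x. Proof. exact: vleUl. Qed.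

Lemma vabs_geN x : - x <= vabs x. Proof. exact: vleUr. Qed.

Lemma vabs_ge0_id x : 0 <= x -> vabs x = x.
Proof.
move=> x0; rewrite /vabs vjoinC; apply: vjoin_r.
by apply: (le_trans _ x0); rewrite -[leRHS]oppr0 vlerN2.
Qed.

Lemma vabs_le0 x : vabs x <= 0 -> x = 0.
Proof.
move=> h; apply/le_anti; rewrite (le_trans (vabs_ge x) h)/=.
by rewrite -vlerN2 oppr0 (le_trans (vabs_geN x) h).
Qed.

Lemma vpos_mono x y : x <= y -> vpos x <= vpos y.
Proof. by move=> xy; rewrite vleUx vleUr (le_trans xy) ?vleUl. Qed.

Lemma vneg_anti x y : x <= y -> vneg y <= vneg x.
Proof. by move=> xy; rewrite !vnegE vpos_mono// vlerN2. Qed.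

Lemma vscaler_le_nat (a : R) x : exists n, a *: x <= vabs x *+ n.
Proof.
wlog a0 : a x / 0 <= a => [hw|].
  have [/hw//|/ltW a0] := leP 0 a.
  have [|n] := hw (- a) (- x); first by rewrite oppr_ge0.
  by rewrite scaleNr scalerN opprK vabsN => h; exists n.
exists (Num.bound a).
apply: (@le_trans _ _ (a *: vabs x)).
  by rewrite -vsubr_ge0 -scalerBr vscaler_ge0// vsubr_ge0 vabs_ge.
rewrite -vsubr_ge0 -scaler_nat -scalerBl vscaler_ge0 ?vabs_ge0// subr_ge0.
exact/ltW/archi_boundP.
Qed.

Lemma vmulrn_ge0 x n : 0 <= x -> 0 <= x *+ n.
Proof.
by move=> x0; elim: n => [|n IH]; rewrite ?mulr0n// mulrS vaddr_ge0.
Qed.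

(** Some natural multiple of [vabs x] dominates both [a *: x] and its opposite, and disjointness
    from [vabs y] survives repeated addition. *)
Lemma disjoint_scale (a : R) x y :
  disjoint_elt x y -> disjoint_elt (a *: x) y.
Proof.
move=> xy; have [n hn] := vscaler_le_nat a x.
have [m hm] := vscaler_le_nat (- a) x.
have H k : (vabs x *+ k) \wedge vabs y = 0.
  elim: k => [|k IH]; first by rewrite mulr0n; apply/vmeet_l/vabs_ge0.
  by rewrite mulrS; apply: vdisjDl; rewrite ?vmulrn_ge0 ?vabs_ge0.
apply: (@vmeet_mono _ _ _ (vabs x *+ (n + m)) _ (vabs y));
  rewrite ?vabs_ge0//.
rewrite vleUx -scaleNr mulrnDr; apply/andP; split.
  by apply: (le_trans hn); apply/vlerDl/vmulrn_ge0/vabs_ge0.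
by apply: (le_trans hm); rewrite addrC; apply/vlerDl/vmulrn_ge0/vabs_ge0.
Qed.

Lemma disjoint_self x : disjoint_elt x x -> x = 0.
Proof. by rewrite /disjoint_elt vmeetxx => h; apply: vabs_le0; rewrite h. Qed.

(** Here [u + v = vabs u + vabs v], and [v <= vabs v] forces [vabs u <= u]. *)
Lemma disjoint_add_ge0 u v : disjoint_elt u v -> 0 <= u + v -> 0 <= u.
Proof.
move=> uv h; have e := vabsD uv; rewrite vabs_ge0_id// in e.
apply: le_trans (vabs_ge0 u) _.
by rewrite -(vlerD2r (vabs v)) -e vlerD2l vabs_ge.
Qed.

Lemma vdisj_add_le u v z : u \wedge v = 0 -> u <= z -> v <= z -> u + v <= z.
Proof. by move=> uv uz vz; rewrite vaddUI uv addr0 vleUx uz. Qed.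

(** Bands quantify over all families, the empty one included. Its supremum would be a least element
    of [E], and then [s <= s + s]. *)
Lemma supremums_set0 s : supremums (@set0 E) s -> s = 0.
Proof.
move=> [_ ls]; have h z : s <= z by apply: ls.
apply/le_anti; rewrite h/= -(vlerD2l s) addr0; exact: h.
Qed.

Lemma disjoint_is_band y : is_band [set x | disjoint_elt x y]%classic.
Proof.
split; first split => /=.
- exact: Defs.disjoint0.
- by move=> a x z xy zy; apply: disjointD => //; exact: disjoint_scale.
- by move=> x z zy xz; apply: disjoint_le zy.
move=> D s DB sup_s; have [D0|/set0P[d0 Dd0]] := eqVneq D set0.
  by move: sup_s; rewrite D0 => /supremums_set0 -> /=; exact: Defs.disjoint0.
have [us ls] := sup_s.
set w := vabs y; have w0 : 0 <= w by exact: vabs_ge0.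
rewrite /= /disjoint_elt vabsE -/w.
apply: vdisjDl; rewrite ?vpos_ge0 ?vneg_ge0//; last first.
  (* From [d0 <= s], the negative part of [s] lies below that of [d0], hence below [vabs d0]. *)
  apply: (@vmeet_mono _ _ _ (vabs d0) _ w); rewrite ?vneg_ge0//.
    exact: le_trans (vneg_anti (us _ Dd0)) (vneg_le_abs _).
  exact: DB.
set t := _ \wedge _; have t0 : 0 <= t by rewrite vlexI vpos_ge0.
(* [s - t] still bounds [D]: [d^+] and [t] are disjoint and both below [s^+]. *)
suff : s <= s - t.
  by rewrite vlerBrD -[leRHS]addr0 vlerD2l => t0'; apply/le_anti/andP.
apply: ls => d Dd; rewrite vlerBrD -[d]vposBneg -[leRHS]vposBneg addrAC.
apply: vlerD; last by rewrite vlerN2; exact/vneg_anti/us.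
apply: vdisj_add_le; [|exact/vpos_mono/us|exact: vleIl].
apply: (@vmeet_mono _ _ _ (vabs d) _ w); rewrite ?vpos_ge0 ?vpos_le_abs//.
  exact: vleIr.
exact: DB.
Qed.

Lemma disjoint_complement_add B (a : R) x y :
  disjoint_complement B x -> disjoint_complement B y ->
  disjoint_complement B (a *: x + y).
Proof.
by move=> hx hy z Bz; apply: disjointD; [apply/disjoint_scale/hx|exact: hy].
Qed.

(** The elements disjoint from [y] form a band containing [x], hence containing the band of [x]. *)
Lemma disjoint_band_generated x y :
  disjoint_elt y x -> disjoint_complement (band_generated x) y.
Proof.
move=> yx z Bz; apply/disjoint_eltC/(Bz _ (disjoint_is_band y)).
exact: disjoint_eltC.
Qed.

(** * The order projection onto a projection band *)

Section ProjectionBand.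
Variables (B : set E) (projB : is_projection_band B).

Let idB : is_ideal B := projB.1.1.

Lemma projection_band_split z : exists u, B u /\ disjoint_complement B (z - u).
Proof.
have [u [v [Bu Bv ->]]] := projB.2 z; exists u; split => //.
by rewrite addrC addKr.
Qed.

Let f z := projT1 (cid (projection_band_split z)).

Let fB z : B (f z).
Proof. by rewrite /f; case: cid => u []. Qed.

Let fBd z : disjoint_complement B (z - f z).
Proof. by rewrite /f; case: cid => u []. Qed.

(** [f z - u] lies in [B] and in its disjoint complement, so it is disjoint from itself. This
    uniqueness makes the chosen component linear and idempotent. *)
Let f_unique z u : B u -> disjoint_complement B (z - u) -> f z = u.
Proof.
move=> Bu Bzu; have [_ idBD _] := idB.
apply/eqP; rewrite -subr_eq0; apply/eqP/disjoint_self.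
have h : disjoint_complement B (f z - u).
  have := disjoint_complement_add (-1) (fBd z) Bzu.
  by rewrite scaleN1r opprB addrA subrK.
by apply: h; have := idBD (-1) _ _ Bu (fB z); rewrite scaleN1r addrC.
Qed.

Lemma projection_band_proj : exists p : order_proj E,
  (forall x, B x -> p x = x) /\ forall x, disjoint_complement B x -> p x = 0.
Proof.
have [idB0 idBD _] := idB.
have fid x : B x -> f x = x.
  by move=> Bx; apply: f_unique => //; rewrite subrr => y _; exact: Defs.disjoint0.
(* The two components of a positive element are disjoint with positive sum, so each is positive. *)
have fge0 x : 0 <= x -> 0 <= f x /\ f x <= x.
  move=> x0; have xE : f x + (x - f x) = x by rewrite addrC subrK.
  have dj : disjoint_elt (x - f x) (f x) by exact: fBd.
  split; last first.
    by rewrite -vsubr_ge0; apply: (disjoint_add_ge0 dj); rewrite addrC xE.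
  by apply: (disjoint_add_ge0 (disjoint_eltC dj)); rewrite xE.
have flin : linear f.
  move=> a x y; apply: f_unique; first exact: idBD.
  have -> : a *: x + y - (a *: f x + f y) = a *: (x - f x) + (y - f y).
    by rewrite opprD addrACA scalerBr.
  exact: disjoint_complement_add.
have fidem x : f (f x) = f x by apply: fid.
have fpos x : 0 <= x -> 0 <= f x by case/fge0.
have fle x : 0 <= x -> f x <= x by case/fge0.
exists (OrderProj flin fidem fpos fle); split => // x Bx /=.
by apply: f_unique => //; rewrite subr0.
Qed.

End ProjectionBand.

(** The projection onto the band of [x] serves: [y] lies in the disjoint complement of that band. *)
Lemma disjoint_separation x y : principal_projection_property E ->
  disjoint_elt x y -> exists p : order_proj E, p x = x /\ p y = 0.
Proof.
move=> ppp xy; have [p [h1 h2]] := projection_band_proj (ppp x).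
exists p; split; first by apply: h1 => B.
exact/h2/disjoint_band_generated/disjoint_eltC.
Qed.

End Disjointness.

(** * Order projections as lattice homomorphisms *)

Section OrderProjectionTheory.
Context {R : realType} {E : vlatticeType R}.
Implicit Types (p : order_proj E) (x y : E).

(** The images of [vpos x] and [vneg x] stay below these disjoint elements, so they are disjoint,
    and their difference is [p x]. *)
Lemma order_proj_pos p x : p (vpos x) = vpos (p x).
Proof.
rewrite -{2}[x]vposBneg linearB/= vposB//.
by apply: (vmeet_mono _ _ _ _ (vpos_neg_disj x));
  rewrite ?order_proj_ge0 ?order_proj_le_id ?vpos_ge0 ?vneg_ge0.
Qed.

Lemma order_proj_neg p x : p (vneg x) = vneg (p x).
Proof. by rewrite !vnegE order_proj_pos linearN. Qed.

Lemma order_proj_join p x y : p (x \vee y) = p x \vee p y.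
Proof. by rewrite !vjoinE linearD/= order_proj_pos linearB. Qed.

Lemma order_proj_meet p x y : p (x \wedge y) = p x \wedge p y.
Proof. by rewrite !vmeetE linearN/= order_proj_join !linearN. Qed.

Lemma order_proj_abs p x : p (vabs x) = vabs (p x).
Proof. by rewrite /vabs order_proj_join linearN. Qed.

Lemma order_proj_abs_le p x : vabs (p x) <= vabs x.
Proof. by rewrite -order_proj_abs order_proj_le_id ?vabs_ge0. Qed.

Lemma order_proj_disjoint p x y :
  disjoint_elt x y -> disjoint_elt (p x) (p y).
Proof. by apply: disjoint_le; exact: order_proj_abs_le. Qed.

Lemma order_proj_dominated p x y : vabs x <= vabs y -> p y = 0 -> p x = 0.
Proof.
move=> /(order_proj_mono p); rewrite !order_proj_abs => h py.
by apply: vabs_le0; rewrite (le_trans h)// py vabs0.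
Qed.

Lemma op_complD p x : p x + op_compl p x = x.
Proof. by rewrite /= addrC subrK. Qed.

Lemma op_compl_proj p x : op_compl p (p x) = 0.
Proof. by rewrite /= order_proj_idem subrr. Qed.

Lemma proj_op_compl p x : p (op_compl p x) = 0.
Proof. by rewrite /= linearB/= order_proj_idem subrr. Qed.

Lemma op_complK p : op_compl (op_compl p) = p.
Proof. by apply: order_proj_ext => x /=; rewrite opprB addrC subrK. Qed.

(** The infimum [z] is the sum of [p z] and [op_compl p z]; each is at most 0, since each projection
    kills one of the two elements bounding [z]. *)
Lemma order_proj_frag p x : disjoint_elt (p x) (op_compl p x).
Proof.
rewrite /disjoint_elt; set z := _ \wedge _.
have z0 : 0 <= z by rewrite vlexI !vabs_ge0.
apply/le_anti; rewrite z0 andbT -(op_complD p z) -[leRHS]addr0.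
apply: vlerD.
  apply: (le_trans (order_proj_mono p (vleIr _ _))).
  by rewrite order_proj_abs proj_op_compl vabs0.
apply: (le_trans (order_proj_mono (op_compl p) (vleIl _ _))).
by rewrite order_proj_abs op_compl_proj vabs0.
Qed.

End OrderProjectionTheory.

(** * Atomic operators and their orthogonal additivity *)

Section AtomicOperators.
Context {R : realType} {E F : vlatticeType R}.
Variable Phi : order_proj E -> order_proj F.
Hypothesis homPhi : boolean_hom Phi.
Implicit Types (T S : E -> F) (p : order_proj E) (x y : E).

Lemma atomic_opsP T :
  atomic_ops Phi T <-> forall p x, T (p x) = Phi p (T x).
Proof.
split=> [h p x|h p]; first by have /(congr1 (fun f => f x)) := h p.
by apply/funext => x /=.
Qed.

Lemma boolean_hom_compl p : Phi (op_compl p) = op_compl (Phi p).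
Proof. by case: homPhi. Qed.

Lemma atomic_ops0 : atomic_ops Phi 0.
Proof. by apply/atomic_opsP => p x /=; rewrite raddf0. Qed.

Lemma atomic_ops_linear (a : R) T S :
  atomic_ops Phi T -> atomic_ops Phi S -> atomic_ops Phi (a *: T + S).
Proof.
move=> /atomic_opsP hT /atomic_opsP hS; apply/atomic_opsP => p x.
by rewrite !addrfctE !scalrfctE linearP/= hT hS.
Qed.

Lemma atomic_join T S : atomic_ops Phi T -> atomic_ops Phi S ->
  atomic_ops Phi (fun x => T x \vee S x).
Proof.
move=> /atomic_opsP hT /atomic_opsP hS; apply/atomic_opsP => p x.
by rewrite order_proj_join hT hS.
Qed.

Lemma atomic_meet T S : atomic_ops Phi T -> atomic_ops Phi S ->
  atomic_ops Phi (fun x => T x \wedge S x).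
Proof.
move=> /atomic_opsP hT /atomic_opsP hS; apply/atomic_opsP => p x.
by rewrite order_proj_meet hT hS.
Qed.

Lemma atomic_pos T : atomic_ops Phi T -> atomic_ops Phi (fun x => vpos (T x)).
Proof. by move=> hT; exact: atomic_join hT atomic_ops0. Qed.

Lemma atomic_neg T : atomic_ops Phi T -> atomic_ops Phi (fun x => vneg (T x)).
Proof.
move=> /atomic_opsP hT; apply/atomic_opsP => p x.
by rewrite order_proj_neg hT.
Qed.

(** Take [p] fixing [x] and killing [y]. The components of [T (x + y)] under [Phi p] and its
    complement are [T (p (x + y)) = T x] and [T (op_compl p (x + y)) = T y]. *)
Lemma atomic_orth_additive T : principal_projection_property E ->
  atomic_ops Phi T -> orth_additive T.
Proof.
move=> ppp /atomic_opsP hT x y xy.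
have [p [px py]] := disjoint_separation ppp xy.
rewrite -[LHS](op_complD (Phi p)) -boolean_hom_compl -!hT/= linearD/= px py addr0.
by rewrite [in X in _ + T X]addrC addKr.
Qed.

Lemma atomic_regular T : principal_projection_property E ->
  atomic_ops Phi T -> regular_oa T.
Proof.
move=> ppp hT.
apply: (@regular_oaP _ _ _ _ (fun x => vpos (T x)) (fun x => vneg (T x))).
- exact/atomic_orth_additive/atomic_pos.
- by move=> x; exact: vpos_ge0.
- exact/atomic_orth_additive/atomic_neg.
- by move=> x; exact: vneg_ge0.
- by apply/funext => x; rewrite addrfctE opprfctE vposBneg.
Qed.

(** Split [S x] along [p]: the hypothesis at [p] says that [Phi p] fixes [S (p x)], and at
    [op_compl p] that [Phi p] kills the other summand. *)
Lemma orth_additive_atomic S : orth_additive S ->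
  (forall p x, Phi (op_compl p) (S (p x)) = 0) -> atomic_ops Phi S.
Proof.
move=> oS h; apply/atomic_opsP => p x.
have h' : Phi p (S (op_compl p x)) = 0.
  by have := h (op_compl p) x; rewrite op_complK.
rewrite -{2}(op_complD p x) oS; last exact: order_proj_frag.
rewrite linearD/= h' addr0.
by rewrite -[LHS](op_complD (Phi p)) -boolean_hom_compl h addr0.
Qed.

Lemma atomic_compl_eq0 T p x : atomic_ops Phi T ->
  Phi (op_compl p) (T (p x)) = 0.
Proof. by move=> /atomic_opsP hT; rewrite hT boolean_hom_compl op_compl_proj. Qed.

(* The block-diagonal part of [S] with respect to the decomposition given by [p]. *)
Definition diag_op p S : E -> F :=
  fun x => Phi p (S (p x)) + Phi (op_compl p) (S (op_compl p x)).

Lemma diag_op_orth_additive p S : orth_additive S -> orth_additive (diag_op p S).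
Proof.
move=> oS x y xy; rewrite /diag_op.
rewrite (linearD p) (linearD (op_compl p)).
rewrite (oS _ _ (order_proj_disjoint p xy)).
rewrite (oS _ _ (order_proj_disjoint (op_compl p) xy)).
by rewrite (linearD (Phi p)) (linearD (Phi (op_compl p))) addrACA.
Qed.

Lemma diag_op_positive p S : positive_op S -> positive_op (diag_op p S).
Proof. by move=> pS x; rewrite vaddr_ge0// order_proj_ge0. Qed.

Lemma diag_op_regular p S : regular_oa S -> regular_oa (diag_op p S).
Proof.
move=> [_ [A [B [[oA pA] [oB pB] ->]]]].
apply: (@regular_oaP _ _ _ _ (diag_op p A) (diag_op p B)).
- exact: diag_op_orth_additive.
- exact: diag_op_positive.
- exact: diag_op_orth_additive.
- exact: diag_op_positive.
apply/funext => x; rewrite /diag_op !addrfctE !opprfctE !linearB/=.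
by rewrite opprD addrACA.
Qed.

Lemma diag_op_atomic p T : atomic_ops Phi T -> diag_op p T = T.
Proof.
move=> /atomic_opsP hT; apply/funext => x.
by rewrite /diag_op !hT !order_proj_idem boolean_hom_compl op_complD.
Qed.

Lemma diag_op_mono p S T :
  (forall x, S x <= T x) -> forall x, diag_op p S x <= diag_op p T x.
Proof. by move=> ST x; apply: vlerD; exact: order_proj_mono. Qed.

Lemma diag_op_proj p S x : S 0 = 0 -> diag_op p S (p x) = Phi p (S (p x)).
Proof.
by move=> S0; rewrite /diag_op op_compl_proj order_proj_idem S0 linear0 addr0.
Qed.

End AtomicOperators.

(** * Pointwise lattice operations and the band property *)

Section AtomicBand.
Context {R : realType} {E : vlatticeType R} {F : dcVlatticeType R}.
Variable Phi : order_proj E -> order_proj F.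
Hypotheses (homPhi : boolean_hom Phi) (pppE : principal_projection_property E).
Implicit Types T S : OAr E F.

Lemma OAr_abs_le S x : vabs (S x) <= vabs S x.
Proof.
have /OAr_lerP h1 := vabs_ge S; have /OAr_lerP h2 := vabs_geN S.
by rewrite vleUx h1 -OAr_oppE h2.
Qed.

(** The pointwise join is atomic, hence regular, hence an upper bound of [T] and [S] inside
    [OAr E F]; the other inequality holds because operators are ordered pointwise. *)
Lemma atomic_joinE T S : atomic_ops Phi T -> atomic_ops Phi S ->
  forall x, (T \vee S) x = T x \vee S x.
Proof.
move=> hT hS x.
have /asboolP rJ := atomic_regular homPhi pppE (atomic_join hT hS).
have /OAr_lerP h1 := vleUl T S; have /OAr_lerP h2 := vleUr T S.
have /OAr_lerP h3 : T \vee S <= MkOAr rJ.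
  by rewrite vleUx; apply/andP; split; apply/OAr_lerP => y /=;
    rewrite ?vleUl ?vleUr.
by apply/le_anti; rewrite (h3 x)/= vleUx h1 h2.
Qed.

Lemma atomic_meetE T S : atomic_ops Phi T -> atomic_ops Phi S ->
  forall x, (T \wedge S) x = T x \wedge S x.
Proof.
move=> hT hS x.
have /asboolP rM := atomic_regular homPhi pppE (atomic_meet hT hS).
have /OAr_lerP h1 := vleIl T S; have /OAr_lerP h2 := vleIr T S.
have /OAr_lerP h3 : MkOAr rM <= T \wedge S.
  by rewrite vlexI; apply/andP; split; apply/OAr_lerP => y /=;
    rewrite ?vleIl ?vleIr.
by apply/le_anti; rewrite (h3 x) andbT vlexI h1 h2.
Qed.

Lemma OAr_atomic0 : atomic_ops Phi (0 : OAr E F).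
Proof. exact: atomic_ops0. Qed.

Lemma OAr_atomicN T : atomic_ops Phi T -> atomic_ops Phi (- T).
Proof.
move=> hT; have -> : - T = (-1) *: T + 0 by rewrite scaleN1r addr0.
exact: atomic_ops_linear hT OAr_atomic0.
Qed.

Lemma atomic_absE T : atomic_ops Phi T -> forall x, vabs T x = vabs (T x).
Proof. by move=> hT x; rewrite (atomic_joinE hT (OAr_atomicN hT)). Qed.

Lemma atomic_solid S T : atomic_ops Phi T -> vabs S <= vabs T ->
  atomic_ops Phi S.
Proof.
move=> hT /OAr_lerP ST; apply: orth_additive_atomic => //.
  exact: OAr_orth_additive.
(* [vabs (S (p x))] is at most [vabs S (p x)], thus at most [vabs T (p x) = vabs (T (p x))]. *)
move=> p x; apply: (@order_proj_dominated _ _ _ _ (T (p x))).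
  by rewrite -(atomic_absE hT); exact: le_trans (OAr_abs_le _ _) (ST _).
exact: atomic_compl_eq0.
Qed.

Lemma atomic_supremum (D : set (OAr E F)) (s : OAr E F) :
  (forall T, D T -> atomic_ops Phi T) -> supremums D s -> atomic_ops Phi s.
Proof.
(* A member [T0] is needed for the lower bound at the end. *)
move=> hD sup_s; have [D0|/set0P[T0 DT0]] := eqVneq D set0.
  by move: sup_s; rewrite D0 => /supremums_set0 ->; exact: OAr_atomic0.
have [us ls] := sup_s; have os := OAr_orth_additive s.
apply: orth_additive_atomic => // p x.
have /asboolP rs := OAr_regular s.
have /asboolP rU := diag_op_regular Phi p rs.
have /OAr_lerP/(_ (p x)) : s <= MkOAr rU.
  (* [diag_op p] is monotone and fixes every atomic [T], so it maps [s] to an upper bound of [D]. *)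
  apply: ls => T DT; apply/OAr_lerP => y /=.
  rewrite -(diag_op_atomic homPhi p (hD _ DT)).
  by apply: diag_op_mono; apply/OAr_lerP/us.
rewrite /= diag_op_proj ?orth_additive0// => h.
apply/le_anti/andP; split.
  by rewrite boolean_hom_compl //= vlerBlD add0r.
(* Conversely [T0 <= s], and the projection kills [T0 (p x)]. *)
rewrite -(atomic_compl_eq0 homPhi p x (hD _ DT0)); apply: order_proj_mono.
by apply/OAr_lerP/us.
Qed.

End AtomicBand.

Theorem theorem2p7 (R : realType) (E : vlatticeType R) (F : dcVlatticeType R)
    (Phi : order_proj E -> order_proj F)
    (archE : archimedean E)
    (pppE : principal_projection_property E)
    (homPhi : boolean_hom Phi) :
  [/\ forall T : E -> F, atomic_ops Phi T -> regular_oa T,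
      is_band [set T : OAr E F | atomic_ops Phi T]%classic
    & forall T S : OAr E F, atomic_ops Phi T -> atomic_ops Phi S ->
      forall x : E,
        [/\ (T \vee S) x = T x \vee S x,
            (T \wedge S) x = T x \wedge S x,
            (vpos T) x = vpos (T x),
            (vneg T) x = vneg (T x)
          & (vabs T) x = vabs (T x)]].
Proof.
split.
(* Regularity ensures that the set in the band clause is all of [atomic_ops Phi]. *)
- by move=> T; exact: atomic_regular.
- split; first split.
  + exact: OAr_atomic0.
  + by move=> a T S; exact: atomic_ops_linear.
  + by move=> S T; exact: atomic_solid.
  + by move=> D s; exact: atomic_supremum.
- move=> T S hT hS x; split.
  + exact: atomic_joinE hT hS x.
  + exact: atomic_meetE hT hS x.
  (* The positive and negative parts unfold to joins of [T] and [- T] with the atomic operator 0. *)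
  + exact: atomic_joinE hT (OAr_atomic0 Phi) x.
  + exact: atomic_joinE (OAr_atomicN hT) (OAr_atomic0 Phi) x.
  + exact: atomic_absE hT x.
Qed.
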